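(* The split square $\mathbb{Q}$ is a strict attractor of the iterated function system $(\mathbb{Q}; f_{ij} : i,j\in\{0,1\})$, where $$f_{ij}(x,y,t) := \left(\frac{x+i}{2},\frac{y+j}{2},t\right),\qquad (x,y,t)\in\mathbb{Q}.$$
   Context: The split square is the set $$\mathbb{Q} = \big([0,1)\times(0,1]\times\{1\}\big)\cup\big((0,1]\times(0,1]\times\{2\}\big)\cup\big((0,1]\times[0,1)\times\{3\}\big)\cup\big([0,1)\times[0,1)\times\{4\}\big)$$ (here $\mathbb{Q}$ does not denote the rationals), endowed with the topology generated by the basis consisting of the sets $$Q(a,b;c,d) := \big([a,b)\times(c,d]\times\{1\}\big)\cup\big((a,b]\times(c,d]\times\{2\}\big)\cup\big((a,b]\times[c,d)\times\{3\}\big)\cup\big([a,b)\times[c,d)\times\{4\}\big),$$ for $0\le a<b\le 1$, $0\le c<d\le 1$. An iterated function system (IFS) $\mathcal{F}=(X; f_i : i\in I)$ is a finite collection of continuous maps $f_i:X\to X$, $i\in I$, on a Hausdorff topological space $X$. $\mathcal{K}(X)$ denotes the set of nonempty compact subsets of $X$ with the Vietoris topology, whose subbasic open sets are $V^{+}=\{S\in\mathcal{K}(X): S\subseteq V\}$ and $V^{-}=\{S\in\mathcal{K}(X): S\cap V\neq\emptyset\}$, $V$ running over all open sets in $X$. The Hutchinson operator of $\mathcal{F}$ is $F:\mathcal{K}(X)\to\mathcal{K}(X)$, $F(K)=\bigcup_{i\in I} f_i(K)$, and $F^n$ is its $n$-fold composition. A set $A\in\mathcal{K}(X)$ is a strict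 attractor of $\mathcal{F}$ if there exists an open set $U\supseteq A$ such that $F^n(K)\to A$ as $n\to\infty$ in the Vietoris topology for every $K\in\mathcal{K}(U)$ (nonempty compact $K\subseteq U$). *)

(* Defs.v *)
From HB Require Import structures.
From mathcomp Require Import all_boot all_order all_algebra.
From mathcomp Require Import all_classical all_reals all_analysis.
From mathcomp Require Import lra.

Set Implicit Arguments.
Unset Strict Implicit.
Unset Printing Implicit Defensive.

Import Order.TTheory GRing.Theory Num.Theory.
Local Open Scope classical_set_scope.
Local Open Scope ring_scope.

Record hyperspace (X : topologicalType) := Hyperspace {
  hyper_set :> set X;
  hyper_nonempty : hyper_set !=set0;
  hyper_compact : compact hyper_set }.

HB.instance Definition _ (X : topologicalType) := gen_eqMixin (hyperspace X).
HB.instance Definition _ (X : topologicalType) :=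
  gen_choiceMixin (hyperspace X).

(* V^+ is indexed by (true, V) and V^- by (false, V). *)
Definition vietoris_subbase (X : topologicalType) (p : bool * set X) :
    set (hyperspace X) :=
  if p.1 then [set S : hyperspace X | S `<=` p.2]
  else [set S : hyperspace X | S `&` p.2 !=set0].

HB.instance Definition _ (X : topologicalType) :=
  isSubBaseTopological.Build (hyperspace X)
    [set p : bool * set X | open p.2] (@vietoris_subbase X).

(* The index type is nonempty, as otherwise the Hutchinson operator would not
   take values in nonempty sets. *)
Record ifs (X : topologicalType) (I : finType) := IFS {
  ifs_map :> I -> X -> X;
  ifs_index_gt0 : (0 < #|I|)%N;
  ifs_hausdorff : hausdorff_space X;
  ifs_continuous : forall i, continuous (ifs_map i) }.

Section Hutchinson.
Context (X : topologicalType) (I : finType) (F : ifs X I).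
Implicit Types K A : hyperspace X.

Definition hutchinson_set (K : set X) : set X := \bigcup_i (F i @` K).

Fact hutchinson_nonempty K : hutchinson_set K !=set0.
Proof.
have [x Kx] := hyper_nonempty K.
have /card_gt0P[i _] := ifs_index_gt0 F.
by exists (F i x), i => //; exists x.
Qed.

Fact hutchinson_compact K : compact (hutchinson_set K).
Proof.
have -> : hutchinson_set K = \big[setU/set0]_(i <- index_enum I) (F i @` K).
  rewrite -bigcup_seq; congr bigcup.
  by apply/seteqP; split=> i _ //=; rewrite mem_index_enum.
apply: bigsetU_compact => i _; apply: continuous_compact.
- exact/continuous_subspaceT/ifs_continuous.
- exact: hyper_compact.
Qed.

Definition hutchinson K : hyperspace X :=
  Hyperspace (hutchinson_nonempty K) (@hutchinson_compact K).

Definition is_strict_attractor (A : set X) : Prop :=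
  exists2 KA : hyperspace X, hyper_set KA = A &
  exists U : set X, [/\ open U, A `<=` U &
    forall K : hyperspace X, K `<=` U ->
      iter n hutchinson K @[n --> \oo] --> KA].

End Hutchinson.

Definition split_box (R : realType) (a b c d : R) : set (R * R * nat) :=
  ([set` `[a, b[] `*` [set` `]c, d]] `*` [set 1%N]) `|`
  ([set` `]a, b]] `*` [set` `]c, d]] `*` [set 2%N]) `|`
  ([set` `]a, b]] `*` [set` `[c, d[] `*` [set 3%N]) `|`
  ([set` `[a, b[] `*` [set` `[c, d[] `*` [set 4%N]).

(* The split square is Q(0,1;0,1) itself, hence the bounds 0 1 0 1. *)
Record split_square (R : realType) := SplitSquare {
  split_val :> R * R * nat;
  split_valP : split_box 0 1 0 1 split_val }.

HB.instance Definition _ (R : realType) := gen_eqMixin (split_square R).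
HB.instance Definition _ (R : realType) := gen_choiceMixin (split_square R).

Definition split_basis_index (R : realType) : set (R * R * R * R) :=
  [set p : R * R * R * R |
    let: (a, b, c, d) := p in
    [&& 0 <= a, a < b & b <= 1] /\ [&& 0 <= c, c < d & d <= 1]].

Definition split_cell (R : realType) (p : R * R * R * R) :
    set (split_square R) :=
  let: (a, b, c, d) := p in @split_val R @^-1` split_box a b c d.

Definition split_basis (R : realType) : set (set (split_square R)) :=
  [set split_cell k | k in @split_basis_index R].

Section SplitSquare.
Context (R : realType).
Implicit Types (a b c d x y : R) (l : bool) (p q : split_square R).

Lemma split_val_inj : injective (@split_val R).
Proof.
by case=> u Pu [v Pv] /= uv; subst v; congr SplitSquare; exact: Prop_irrelevance.
Qed.

Definition half_open l a b x := if l then a <= x < b else a < x <= b.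

Lemma split_boxE a b c d x y (t : nat) : split_box a b c d (x, y, t) <->
  [/\ (1 <= t <= 4)%N, half_open ((t == 1) || (t == 4))%N a b x &
      half_open (3 <= t)%N c d y].
Proof.
rewrite /split_box /half_open /=; split.
  by move=> [[[[[+ +] ->]|[[+ +] ->]]|[[+ +] ->]]|[[+ +] ->]];
    rewrite !in_itv; split.
case: t => [|[|[|[|[|t]]]]] [] //= _ hx hy.
- by left; left; left; rewrite !in_itv.
- by left; left; right; rewrite !in_itv.
- by left; right; rewrite !in_itv.
- by right; rewrite !in_itv.
Qed.

Lemma half_openI l a b a' b' x :
  half_open l (Num.max a a') (Num.min b b') x =
  half_open l a b x && half_open l a' b' x.
Proof.
by rewrite /half_open; case: l;
  rewrite ?ge_max ?gt_max ?le_min ?lt_min andbACA.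
Qed.

Lemma half_open_lt l a b x : half_open l a b x -> a < b.
Proof. by rewrite /half_open; case: l => /andP[? ?]; lra. Qed.

Lemma max_min_itv l a b a' b' x :
  [&& 0 <= a, a < b & b <= 1] -> [&& 0 <= a', a' < b' & b' <= 1] ->
  half_open l a b x -> half_open l a' b' x ->
  [&& 0 <= Num.max a a', Num.max a a' < Num.min b b' & Num.min b b' <= 1].
Proof.
move=> /and3P[a0 ab b1] /and3P[a'0 ab' b'1] h h'.
have /half_open_lt -> : half_open l (Num.max a a') (Num.min b b') x.
  by rewrite half_openI h h'.
by rewrite le_max a0 ge_min b1.
Qed.

Lemma split_cell_cover :
  \bigcup_(k in @split_basis_index R) split_cell k = setT.
Proof.
apply/seteqP; split=> // p _.
exists ((0, 1, 0, 1) : R * R * R * R); last exact: split_valP.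
by rewrite /split_basis_index /= !lexx ltr01.
Qed.

Lemma split_cell_join k k' p :
  split_basis_index k -> split_basis_index k' ->
  split_cell k p -> split_cell k' p ->
  exists m, [/\ split_basis_index m, split_cell m p &
    split_cell m `<=` split_cell k `&` split_cell k'].
Proof.
case: k => [[[a b] c] d]; case: k' => [[[a' b'] c'] d'] /=.
case: p => [[[x y] t] P] [ab cd] [ab' cd'] /=.
move=> /split_boxE[t4 hx hy] /split_boxE[_ hx' hy'].
exists (Num.max a a', Num.min b b', Num.max c c', Num.min d d'); split.
- split; [exact: max_min_itv hx hx'|exact: max_min_itv hy hy'].
- by apply/split_boxE; rewrite !half_openI; split=> //; apply/andP.
- case=> [[[u v] s] Q] /= /split_boxE[s4].
  rewrite !half_openI => /andP[hu hu'] /andP[hv hv'].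
  by split; apply/split_boxE.
Qed.

Lemma split_basis_cover : \bigcup_(A in @split_basis R) id A = setT.
Proof. by rewrite bigcup_image; exact: split_cell_cover. Qed.

Lemma split_basis_join (A B : set (split_square R)) p :
  split_basis A -> split_basis B -> id A p -> id B p ->
  exists C, [/\ split_basis C, id C p & id C `<=` id A `&` id B].
Proof.
move=> [k kD <-] [k' k'D <-] kp k'p.
have [m [mD mp mkk']] := split_cell_join kD k'D kp k'p.
by exists (split_cell m); split=> //; exists m.
Qed.

HB.instance Definition _ := isBaseTopological.Build (split_square R)
  split_basis_cover split_basis_join.

Lemma open_split_cell k : split_basis_index k -> open (split_cell k).
Proof.
move=> kD; exists [set split_cell k]; last by rewrite bigcup_set1.
by move=> _ ->; exists k.
Qed.

Lemma nbhs_split_cell p (A : set (split_square R)) : nbhs p A ->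
  exists k, [/\ split_basis_index k, split_cell k p & split_cell k `<=` A].
Proof.
rewrite nbhsE => -[B [[D' D'D <-] [C D'C Cp]] BA].
have [k kD kC] := D'D _ D'C; exists k; rewrite kC; split=> // q kq.
by apply: BA; exists C.
Qed.

Lemma separate_cells k k' p q :
  split_basis_index k -> split_basis_index k' ->
  split_cell k p -> split_cell k' q ->
  split_cell k `&` split_cell k' = set0 ->
  exists2 AB, (p \in AB.1 /\ q \in AB.2) &
    [/\ open AB.1, open AB.2 & AB.1 `&` AB.2 == set0].
Proof.
move=> kD k'D kp k'q kk'; exists (split_cell k, split_cell k') => /=.
  by rewrite !inE.
by split; [exact: open_split_cell..|exact/eqP].
Qed.

Lemma half_open_cut l l' x x' : half_open l 0 1 x -> half_open l' 0 1 x' ->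
  (x, l) != (x', l') -> exists m, [/\ 0 < m < 1 &
    half_open l 0 m x /\ half_open l' m 1 x' \/
    half_open l m 1 x /\ half_open l' 0 m x'].
Proof.
move=> hx hx' ne; have [xx'|xx'|xx'] := ltgtP x x'.
- exists ((x + x') / 2); move: hx hx'; rewrite /half_open.
  by case: l ne; case: l' => _ /andP[? ?] /andP[? ?]; split; [lra|left; lra|
   lra|left; lra|lra|left; lra|lra|left; lra].
- exists ((x + x') / 2); move: hx hx'; rewrite /half_open.
  by case: l ne; case: l' => _ /andP[? ?] /andP[? ?]; split; [lra|right; lra|
   lra|right; lra|lra|right; lra|lra|right; lra].
- subst x'; exists x; move: ne hx hx'; rewrite xpair_eqE eqxx /= /half_open.
  case: l; case: l' => //= _ /andP[? ?] /andP[? ?].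
  + by split; [lra|right; lra].
  + by split; [lra|left; lra].
Qed.

Lemma half_open_disj l a m b x : ~ (half_open l a m x /\ half_open l m b x).
Proof. by rewrite /half_open; case: l => -[]/andP[? ?] /andP[? ?]; lra. Qed.

Fact split_square_hausdorff : hausdorff_space (split_square R).
Proof.
rewrite open_hausdorff => p q /eqP pq.
have {pq} : split_val p <> split_val q by move/split_val_inj.
case: p => [[[x y] t] P]; case: q => [[[x' y'] t'] P'] /= ne.
have [t4 hx hy] := (split_boxE _ _ _ _ _ _ _).1 P.
have [t4' hx' hy'] := (split_boxE _ _ _ _ _ _ _).1 P'.
have [xx|/(half_open_cut hx hx')[m [m01 H]]] :=
    eqVneq (x, (t == 1) || (t == 4))%N (x', (t' == 1) || (t' == 4))%N.
  have [yy|/(half_open_cut hy hy')[m [m01 H]]] :=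
      eqVneq (y, (3 <= t)%N) (y', (3 <= t')%N).
    exfalso; apply: ne; case: xx yy => -> tt [->] tt'; congr (_, _).
    by case: t t' t4 t4' tt tt' {P P' hx hy hx' hy'} =>
      [|[|[|[|[|t]]]]] [|[|[|[|[|t']]]]].
  case: H => -[h h'].
  - apply: (@separate_cells (0, 1, 0, m) (0, 1, m, 1)).
    + by split; lra.
    + by split; lra.
    + exact/split_boxE.
    + exact/split_boxE.
    + apply/seteqP; split=> // -[[[u v] s] Q] /= [/split_boxE[_ _ h1]].
      by move=> /split_boxE[_ _ h2]; exact: (half_open_disj (conj h1 h2)).
  - apply: (@separate_cells (0, 1, m, 1) (0, 1, 0, m)).
    + by split; lra.
    + by split; lra.
    + exact/split_boxE.
    + exact/split_boxE.
    + apply/seteqP; split=> // -[[[u v] s] Q] /= [/split_boxE[_ _ h1]].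
      by move=> /split_boxE[_ _ h2]; exact: (half_open_disj (conj h2 h1)).
case: H => -[h h'].
- apply: (@separate_cells (0, m, 0, 1) (m, 1, 0, 1)).
  + by split; lra.
  + by split; lra.
  + exact/split_boxE.
  + exact/split_boxE.
  + apply/seteqP; split=> // -[[[u v] s] Q] /= [/split_boxE[_ h1 _]].
    by move=> /split_boxE[_ h2 _]; exact: (half_open_disj (conj h1 h2)).
- apply: (@separate_cells (m, 1, 0, 1) (0, m, 0, 1)).
  + by split; lra.
  + by split; lra.
  + exact/split_boxE.
  + exact/split_boxE.
  + apply/seteqP; split=> // -[[[u v] s] Q] /= [/split_boxE[_ h1 _]].
    by move=> /split_boxE[_ h2 _]; exact: (half_open_disj (conj h2 h1)).
Qed.

Definition split_fun (ij : 'I_2 * 'I_2) (p : R * R * nat) : R * R * nat :=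
  let: (x, y, t) := p in
  ((x + ij.1%:R) / 2, (y + ij.2%:R) / 2, t).

Lemma ord2_bounds (i : 'I_2) : 0 <= (i%:R : R) <= 1.
Proof. by rewrite ler0n lern1 -ltnS ltn_ord. Qed.

Lemma half_open_half l (i : 'I_2) x : half_open l 0 1 x ->
  half_open l 0 1 ((x + i%:R) / 2).
Proof.
have := ord2_bounds i; rewrite /half_open.
by case: l => /andP[? ?] /andP[? ?]; lra.
Qed.

Fact split_fun_subproof ij p : split_box 0 1 0 1 (split_fun ij p).
Proof.
case: p => [[[x y] t] /= /split_boxE[t4 hx hy]].
by apply/split_boxE; split=> //; exact: half_open_half.
Qed.

Definition split_map ij p : split_square R :=
  SplitSquare (split_fun_subproof ij p).

Lemma half_open_preim l a b (i : 'I_2) x : half_open l 0 1 x ->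
  half_open l a b ((x + i%:R) / 2) ->
  exists a' b', [/\ [&& 0 <= a', a' < b' & b' <= 1], half_open l a' b' x &
    forall l' y, half_open l' a' b' y -> half_open l' a b ((y + i%:R) / 2)].
Proof.
move=> h01 hab.
exists (Num.max 0 (2 * a - i%:R)), (Num.min 1 (2 * b - i%:R)).
have hx : half_open l (Num.max 0 (2 * a - i%:R)) (Num.min 1 (2 * b - i%:R)) x.
  rewrite half_openI h01 /=; move: hab; rewrite /half_open.
  by case: l {h01} => /andP[? ?]; lra.
split=> //.
- by rewrite (half_open_lt hx) le_max lexx ge_min lexx.
- move=> l' y; rewrite half_openI => /andP[_]; rewrite /half_open.
  by case: l' => /andP[? ?]; lra.
Qed.

Fact split_map_continuous ij : continuous (split_map ij).
Proof.
move=> p A /nbhs_split_cell[[[[a b] c] d] [[ab cd] + kA]].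
case: p => [[[x y] t] P]; have [t4 hx hy] := (split_boxE _ _ _ _ _ _ _).1 P.
move=> /= /split_boxE[_ hx' hy'].
have [a' [b' [ab' xab' Hx]]] := half_open_preim hx hx'.
have [c' [d' [cd' ycd' Hy]]] := half_open_preim hy hy'.
rewrite nbhs_simpl /= nbhsE; exists (split_cell (a', b', c', d')).
  by split; [exact: open_split_cell|exact/split_boxE].
move=> [[[u v] s] Q] /= /split_boxE[s4 hu hv]; apply: kA => /=.
by apply/split_boxE; split=> //; [exact: Hx|exact: Hy].
Qed.

Fact split_index_gt0 : (0 < #|{: 'I_2 * 'I_2}|)%N.
Proof. by rewrite card_prod !card_ord. Qed.

Definition split_ifs : ifs (split_square R) ('I_2 * 'I_2)%type :=
  IFS split_index_gt0 split_square_hausdorff split_map_continuous.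

End SplitSquare.

(* Main.v *)
Require Import Defs.
From mathcomp Require Import all_boot all_order all_algebra.
From mathcomp Require Import all_classical all_reals all_analysis.
From mathcomp Require Import ring lra.

(** The split square is a product of two copies of the double arrow space, the
    points [x+] and [x-] being encoded as [(x, true)] and [(x, false)].  An
    ultrafilter on the double arrow space converges to [s+] or [s-], where [s]
    is the supremum of the cuts [m] such that [{y | y > m}] belongs to it;
    hence the split square is compact.  Being the whole space, it is the limit
    of [F^n(K)] as soon as [F^n(K)] eventually meets every cell: for [(x,y,t)]
    in [K], [F^n(K)] contains all the points [((x+k)/2^n, (y+m)/2^n, t)] with
    [k, m < 2^n], which form a grid of step [2^-n]. *)

Set Implicit Arguments.
Unset Strict Implicit.
Unset Printing Implicit Defensive.

Import Order.TTheory GRing.Theory Num.Theory.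
Local Open Scope classical_set_scope.
Local Open Scope ring_scope.

(** A basic Vietoris neighbourhood is a finite intersection of sets [V^+] and [V^-], and a filter is
    stable under finite intersections. *)
Lemma vietoris_cvg (X : topologicalType) (F : set_system (hyperspace X))
    (A : hyperspace X) : Filter F ->
  (forall V, open V -> A `<=` V -> F [set S : hyperspace X | S `<=` V]) ->
  (forall V, open V -> A `&` V !=set0 ->
    F [set S : hyperspace X | S `&` V !=set0]) ->
  F --> A.
Proof.
move=> FF Fsub Fmeet W; rewrite nbhsE => -[B [[D' D'D <-] [C D'C CA]] BW].
have [E ED EC] := D'D _ D'C.
apply: (@filterS _ F _ C) => [S CS|]; first by apply: BW; exists C.
rewrite -EC; apply: filter_bigI => -[[] V] iE.
- have /set_mem oV := ED _ iE; apply: Fsub => //.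
  by move: CA; rewrite -EC => /(_ _ iE).
- have /set_mem oV := ED _ iE; apply: Fmeet => //.
  by move: CA; rewrite -EC => /(_ _ iE).
Qed.

Section DoubleArrow.
Context (R : realType).
Implicit Types (a b x : R) (l : bool).

Lemma half_open_compl l m x : 0 <= m <= 1 -> half_open l 0 1 x ->
  ~ half_open l m 1 x -> half_open l 0 m x.
Proof.
rewrite /half_open; case: l => /andP[? ?] /andP[? ?] /negP;
  by rewrite negb_and -?leNgt -?ltNge => /orP[|] ?; lra.
Qed.

Lemma half_openW l a b a' b' x : a' <= a -> b <= b' ->
  half_open l a b x -> half_open l a' b' x.
Proof. by rewrite /half_open; case: l => ? ? /andP[? ?]; lra. Qed.

(** Compactness of the double arrow space, stated for a family [(f, s)] over any [T] so that one
    ultrafilter on the split square can be used with either coordinate. *)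
Lemma double_arrow_ultra (T : Type) (U : set_system T) (f : T -> R)
    (s : T -> bool) : UltraFilter U ->
  (forall p, half_open (s p) 0 1 (f p)) ->
  exists l x, half_open l 0 1 x /\
    forall a b, half_open l a b x ->
      U [set p | half_open (s p) a b (f p)].
Proof.
move=> UU f01.
pose A a b := [set p | half_open (s p) a b (f p)].
have A01 : U (A 0 1) by apply: filterS filterT => p _; exact: f01.
pose E := [set m : R | 0 <= m /\ U (A m 1)].
have E0 : E 0 by split.
have E1 m : E m -> m < 1.
  by move=> [m0 /filter_ex[p /half_open_lt]].
have supE : has_sup E by split; [exists 0|exists 1 => m /E1/ltW].
have s0 : 0 <= sup E by exact: ub_le_sup supE.2 _ E0.
have s1 : sup E <= 1 by apply: ge_sup => [|m /E1/ltW//]; exists 0.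
have UC m : 0 <= m <= 1 -> ~ U (A m 1) -> U (A 0 m).
  move=> m01 nA; have [//|UnA] := in_ultra_setVsetC (A m 1) UU.
  by apply: filterS UnA => p /half_open_compl; apply.
have UI m b : U (A m 1) -> U (A 0 b) -> U (A m b).
  move=> Am Ab; apply: filterS2 Am Ab => p /=.
  by rewrite /A /half_open /=; case: (s p) => /andP[? ?] /andP[? ?]; lra.
have [As|nAs] := pselect (U (A (sup E) 1)).
- have Es : E (sup E) by split.
  exists true, (sup E); split; first by rewrite /half_open s0 E1.
  move=> a b /andP[a_s sb].
  (* Truncating at 1 keeps the cut in the unit interval; lying above [sup E], it is not in [E], so
     the complement [A 0 b'] is in [U]. *)
  pose b' := Num.min b 1.
  have sb' : sup E < b' by rewrite lt_min sb E1.
  have b'1 : b' <= 1 by rewrite ge_min lexx orbT.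
  have Ab' : U (A 0 b').
    apply: UC; first by rewrite b'1 (le_trans s0 (ltW sb')).
    move=> Ab'; suff : b' <= sup E by rewrite leNgt sb'.
    by apply: ub_le_sup => //; [exact: supE.2|split=> //; lra].
  apply: filterS (UI _ _ As Ab') => p; apply: half_openW => //.
  by rewrite ge_min lexx.
- have s_gt0 : 0 < sup E.
    by rewrite lt_neqAle s0 andbT; apply: contra_notN nAs => /eqP <-.
  exists false, (sup E); split; first by rewrite /half_open s_gt0 s1.
  move=> a b /andP[a_s sb].
  (* A cut in [E] above [a] bounds from below; the upper bound is [sup E] itself, which is not in
     [E]. *)
  have [m [m0 Am] am] := sup_gt (ex_intro _ 0 E0) a_s.
  have := UI _ _ Am (UC _ (introT andP (conj s0 s1)) nAs).
  by apply: filterS => p; apply: half_openW => //; exact: ltW.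
Qed.

Lemma dyadic_between a b x n : 0 <= a -> b <= 1 -> 0 <= x <= 1 ->
  2 < 2 ^+ n * (b - a) ->
  exists2 k, (k < 2 ^ n)%N & a < (x + k%:R) / 2 ^+ n < b.
Proof.
move=> a0 b1 /andP[x0 x1]; set N : R := 2 ^+ n => Nba.
have N0 : 0 < N by rewrite exprn_gt0.
have Na0 : 0 <= a * N by rewrite mulr_ge0 // ltW.
have /andP[k1 k2] := truncn_itv Na0.
have k3 : (Num.truncn (a * N)).+1%:R <= a * N + 1 :> R.
  by rewrite -natr1 lerD2r.
(* With [k] the integer just above [a * N], [x + k] exceeds [a * N] and is at most
   [a * N + 2 < b * N]. *)
exists (Num.truncn (a * N)).+1.
  rewrite -(ltr_nat R) natrX -/N.
  have : b * N <= N by rewrite ler_piMl // ltW.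
  lra.
rewrite ltr_pdivlMr // ltr_pdivrMr //; lra.
Qed.

End DoubleArrow.

Section SplitSquare.
Context (R : realType).

Lemma split_square_compact : compact [set: split_square R].
Proof.
rewrite compact_ultra => U UU _.
have bd (p : split_square R) : [/\ (1 <= p.2 <= 4)%N,
    half_open ((p.2 == 1) || (p.2 == 4))%N 0 1 p.1.1 &
    half_open (3 <= p.2)%N 0 1 p.1.2].
  by case: p => [[[x y] t] P]; apply/split_boxE.
have hx (p : split_square R) :
  half_open ((p.2 == 1) || (p.2 == 4))%N 0 1 p.1.1 by case: (bd p).
have hy (p : split_square R) : half_open (3 <= p.2)%N 0 1 p.1.2.
  by case: (bd p).
have [l [x [x01 Ux]]] := double_arrow_ultra UU hx.
have [l' [y [y01 Uy]]] := double_arrow_ultra UU hy.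
have [t [t4 tl tl']] : exists t, [/\ (1 <= t <= 4)%N,
    ((t == 1) || (t == 4))%N = l & (3 <= t)%N = l'].
  (* The two orientations determine the sheet. *)
  exists (if l' then if l then 4 else 3 else if l then 1 else 2)%N.
  by move: l l' {x01 y01 Ux Uy} => [] [].
have P : split_box 0 1 0 1 (x, y, t) by apply/split_boxE; rewrite tl tl'.
exists (SplitSquare P); split=> // W.
move=> /nbhs_split_cell[[[[a b] c] d] [_ /split_boxE[_ + +] kW]].
rewrite tl tl' => /Ux Uab /Uy Ucd.
apply: filterS2 Uab Ucd => p pab pcd; apply: kW.
case: p (bd p) pab pcd => [[[u v] r] Q] /= [r4 _ _] pab pcd.
exact/split_boxE.
Qed.

(** By induction on [n]: the leading binary digit of [k] and [m] selects the last map applied, the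
    remainders modulo [2 ^ n] the earlier ones. *)
Lemma iter_split_ifs (K : hyperspace (split_square R)) x y t n k m
    (P : split_box 0 1 0 1 (x, y, t)) : hyper_set K (SplitSquare P) ->
  (k < 2 ^ n)%N -> (m < 2 ^ n)%N ->
  exists2 q, hyper_set (iter n (hutchinson (split_ifs R)) K) q &
    split_val q = ((x + k%:R) / 2 ^+ n, (y + m%:R) / 2 ^+ n, t).
Proof.
move=> KP; elim: n k m => [|n IH] k m kn mn.
  move: kn mn; rewrite expn0 !ltnS !leqn0 => /eqP-> /eqP->.
  by exists (SplitSquare P) => //=; rewrite !addr0 !divr1.
have n0 : (0 < 2 ^ n)%N by rewrite expn_gt0.
have div2 j : (j < 2 ^ n.+1)%N -> (j %/ 2 ^ n < 2)%N.
  by rewrite expnS ltn_divLR.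
have step z j (jn : (j < 2 ^ n.+1)%N) :
    ((z + (j %% 2 ^ n)%:R) / 2 ^+ n + (Ordinal (div2 _ jn))%:R) / 2 =
    (z + j%:R) / 2 ^+ n.+1 :> R.
  rewrite [in RHS](divn_eq j (2 ^ n)) natrD natrM natrX /= exprS.
  have N0 : (2 ^+ n : R) != 0 by rewrite expf_neq0.
  by field.
have [q qK qE] := IH _ _ (ltn_pmod k n0) (ltn_pmod m n0).
exists (split_map (Ordinal (div2 _ kn), Ordinal (div2 _ mn)) q).
  by exists (Ordinal (div2 _ kn), Ordinal (div2 _ mn)) => //; exists q.
by rewrite /= qE /= -!step.
Qed.

Lemma near_iter_meets_cell (K : hyperspace (split_square R)) k :
  split_basis_index k ->
  \forall n \near \oo,
    iter n (hutchinson (split_ifs R)) K `&` split_cell k !=set0.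
Proof.
case: k => [[[a b] c] d] [/and3P[a0 ab b1] /and3P[c0 cd d1]].
have [[[[x y] t] P] KP] := hyper_nonempty K.
have [t4 hx hy] := (split_boxE _ _ _ _ _ _ _).1 P.
have unit l (z : R) : half_open l 0 1 z -> 0 <= z <= 1.
  by rewrite /half_open; case: l => /andP[? ?]; lra.
(* Aiming at the open interval makes the sheet of the starting point irrelevant. *)
have inner l (u v z : R) : u < z < v -> half_open l u v z.
  by move=> /andP[? ?]; rewrite /half_open; case: l; lra.
have fine (u v : R) : u < v -> \forall n \near \oo, 2 < 2 ^+ n * (v - u).
  rewrite -subr_gt0 => uv; near=> n; rewrite -ltr_pdivrMr //.
  (* Eventually [2 / (v - u) < n < 2 ^ n]. *)
  apply: (@lt_trans _ _ n%:R); last by rewrite -natrX ltr_nat ltn_expl.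
  by near: n; exact: nbhs_infty_gtr.
have abn := fine _ _ ab; have cdn := fine _ _ cd.
near=> n.
have [i i_lt iab] : exists2 i, (i < 2 ^ n)%N & a < (x + i%:R) / 2 ^+ n < b.
  by apply: dyadic_between => //; [exact: unit hx|near: n].
have [j j_lt jcd] : exists2 j, (j < 2 ^ n)%N & c < (y + j%:R) / 2 ^+ n < d.
  by apply: dyadic_between => //; [exact: unit hy|near: n].
have [q qK qE] := iter_split_ifs KP i_lt j_lt.
exists q; split=> //; rewrite /split_cell /preimage /= qE.
by apply/split_boxE; split=> //; exact: inner.
Unshelve. all: by end_near. Qed.

Lemma split_square_nonempty : [set: split_square R] !=set0.
Proof.
have P : split_box 0 1 0 1 ((0, 0, 4%N) : R * R * nat).
  by apply/split_boxE; rewrite /half_open lexx ltr01.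
by exists (SplitSquare P).
Qed.

End SplitSquare.

Theorem theorem3p3 (R : realType) :
  is_strict_attractor (split_ifs R) [set: split_square R]%classic.
Proof.
exists (Hyperspace (split_square_nonempty R) (@split_square_compact R)) => //.
exists setT; split=> // [|K _]; first exact: openT.
apply: (@vietoris_cvg _
  ((fun n => iter n (hutchinson (split_ifs R)) K) @ \oo)).
  by move=> V oV TV; apply: (@nearW _ \oo) => n S _; exact: TV.
move=> V oV [p [_ Vp]].
(* Meeting a single cell inside [V] suffices. *)
have [k [kD _ kV]] := nbhs_split_cell (open_nbhs_nbhs (conj oV Vp)).
apply: (@filterS _ \oo) (near_iter_meets_cell K kD) => n [q [Kq kq]].
by exists q; split=> //; exact: kV.
Qed.
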